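(* Let $p\ge1$, $1\le m\le n$ and $k\ge0$ be integers. Then $$(Q^{(m)})^{*k}=\sum_{a=0}^{n}\mu_k^{(m)}(a)\,\widetilde Q_{a,p}=\sum_{u=0}^{n}P_k^{(m)}(u)\,\widetilde Q_{n-u,p}.$$ In particular, $P_k^{(m)}(u)=\mu_k^{(m)}(n-u)$ for $0\le u\le n$, i.e. $(Q^{(m)})^{*k}$ is the mixture $\sum_{a=0}^n\mu(a)\widetilde Q_{a,p}$ with $\mu=\mu_k^{(m)}$. If $k\ge1$, then $$\mu_k^{(m)}(a)=\frac{1}{((n)_m)^k}\binom na\sum_{j=0}^{a}(-1)^j\binom aj\bigl((a-j)_m\bigr)^k,\qquad 0\le a\le n,$$ where $(x)_m=x(x-1)\cdots(x-m+1)$, with the convention $(x)_m=0$ for $x<m$.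
   Context: For integers $n,p\ge1$, $C_p=\mathbb Z/p\mathbb Z$ (written additively) and $G_{n,p}=C_p\wr S_n$ is the group of $p$-colored permutations, realized as $C_p^{\,n}\times S_n$ with multiplication $(t,\tau)(s,\sigma)=(\sigma t+s,\tau\sigma)$, $\sigma t:=(t_{\sigma(1)},\dots,t_{\sigma(n)})$. In $(s,\sigma)$, position $i$ carries the label $\sigma(i)$ with color $s_i$. Convolution is $(M*N)(z)=\sum_uM(zu^{-1})N(u)$, $M^{*k}$ is the $k$-fold convolution power and $M^{*0}=\delta_e$. For $0\le a\le n$, $\widetilde Q_{a,p}$ is the uniform probability measure on the set of $(s,\sigma)\in G_{n,p}$ with $\sigma^{-1}(a+1)<\cdots<\sigma^{-1}(n)$ and $s_{\sigma^{-1}(j)}=0$ for $a+1\le j\le n$ (so $\widetilde Q_{0,p}=\delta_e$ and $\widetilde Q_{n,p}$ is uniform on $G_{n,p}$). $Q^{(m)}:=\widetilde Q_{m,p}$. Occupancy model: for rounds $t=1,\dots,k$, choose independent uniformly random $m$-element subsets $S_t\subseteq[n]$. Let $A:=|\bigcup_{t=1}^kS_t|$ and $E:=n-A$. Then $\mu_k^{(m)}(a):=\mathbb P(A=a)$ and $P_k^{(m)}(u):=\mathbb P(E=u)$ for $0\le a,u\le n$. *)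

(* Defs.v *)
From HB Require Import structures.
From mathcomp Require Import all_boot all_order all_algebra all_fingroup.
Set Implicit Arguments.
Unset Strict Implicit.
Unset Printing Implicit Defensive.
Import Order.TTheory GRing.Theory Num.Theory.
Local Open Scope ring_scope.

(* For p > 0 this is the additive group Z/pZ, including the trivial group when
   p = 1, where 'Z_p would be Z/2Z. *)
Notation Cyc p := 'I_p.-1.+1 (only parsing).

(* Positions and labels are 0-based: the label j + 1 of the mathematical
   convention is (j : 'I_n), and likewise for positions. *)
Record cperm (n p : nat) := CPerm {
  color : {ffun 'I_n -> Cyc p};
  label : 'S_n
}.

Section ColoredPermGroup.
Variables n p : nat.

Definition cperm_pair (x : cperm n p) := (color x, label x).
Definition pair_cperm (y : {ffun 'I_n -> Cyc p} * 'S_n) := CPerm y.1 y.2.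

Lemma cperm_pairK : cancel cperm_pair pair_cperm.
Proof. by case. Qed.

HB.instance Definition _ := Finite.copy (cperm n p) (can_type cperm_pairK).

(* (t, tau) (s, sigma) = (sigma t + s, tau sigma), where
   (sigma t)_i = t_(sigma i) and tau sigma is "first sigma, then tau"; the
   product of 'S_n composes in the opposite order, so it is sigma * tau. *)
Definition cperm_mul (x y : cperm n p) : cperm n p :=
  CPerm [ffun i => color x (label y i) + color y i] (label y * label x)%g.

Definition cperm_one : cperm n p := CPerm [ffun=> 0] 1%g.

Definition cperm_inv (x : cperm n p) : cperm n p :=
  CPerm [ffun i => - color x ((label x)^-1%g i)] (label x)^-1%g.

Lemma cperm_mulA : associative cperm_mul.
Proof.
move=> [r rho] [t tau] [s sigma]; rewrite /cperm_mul /= mulgA.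
by congr CPerm; apply/ffunP=> i; rewrite !ffunE permM addrA.
Qed.

Lemma cperm_mul1 : left_id cperm_one cperm_mul.
Proof.
move=> [s sigma]; rewrite /cperm_mul /= mulg1.
by congr CPerm; apply/ffunP=> i; rewrite !ffunE add0r.
Qed.

Lemma cperm_mulV : left_inverse cperm_one cperm_inv cperm_mul.
Proof.
move=> [s sigma]; rewrite /cperm_mul /cperm_inv /= mulgV.
by congr CPerm; apply/ffunP=> i; rewrite !ffunE permK addNr.
Qed.

HB.instance Definition _ :=
  Finite_isGroup.Build (cperm n p) cperm_mulA cperm_mul1 cperm_mulV.

End ColoredPermGroup.

(* A measure on a finite type is represented by its mass function. *)
Definition unif (R : realFieldType) (T : finType) (D : {set T}) :
    {ffun T -> R} :=
  [ffun x => if x \in D then #|D|%:R^-1 else 0].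

Definition dirac (R : realFieldType) (T : finType) (x : T) : {ffun T -> R} :=
  [ffun y => (y == x)%:R].

Definition prob (R : realFieldType) (T : finType) (P : {ffun T -> R})
    (D : pred T) : R :=
  \sum_(x | D x) P x.

Definition conv (R : realFieldType) (gT : finGroupType)
    (M N : {ffun gT -> R}) : {ffun gT -> R} :=
  [ffun z => \sum_u M (z * u^-1)%g * N u].

Definition convpow (R : realFieldType) (gT : finGroupType)
    (M : {ffun gT -> R}) (k : nat) : {ffun gT -> R} :=
  iter k (conv M) (dirac R (1%g : gT)).

(* The labels a + 1, ..., n are the 0-based labels j with a <= j. *)
Definition Qset (n p a : nat) : {set cperm n p} :=
  [set x : cperm n p |
    [forall i : 'I_n, forall j : 'I_n,
      (a <= i)%N && (i < j)%N ==>
        ((label x)^-1%g i < (label x)^-1%g j)%N]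
    && [forall j : 'I_n,
      (a <= j)%N ==> (color x ((label x)^-1%g j) == 0)]].

Definition Qt (R : realFieldType) (n p a : nat) : {ffun cperm n p -> R} :=
  unif R (Qset n p a).

(* An outcome of the occupancy model is (S_1, ..., S_k), and independence of
   the rounds means that its law is the product of the laws of the S_t. *)
Definition occ_law (R : realFieldType) (n m k : nat) :
    {ffun {ffun 'I_k -> {set 'I_n}} -> R} :=
  [ffun S : {ffun 'I_k -> {set 'I_n}} =>
    \prod_(t < k) unif R [set B : {set 'I_n} | #|B| == m] (S t)].

Definition occupied (n k : nat) (S : {ffun 'I_k -> {set 'I_n}}) : nat :=
  #|\bigcup_(t < k) S t|.

Definition empties (n k : nat) (S : {ffun 'I_k -> {set 'I_n}}) : nat :=
  (n - occupied S)%N.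

Definition occ_mu (R : realFieldType) (n m k a : nat) : R :=
  prob (occ_law R n m k) (fun S => occupied S == a).

Definition occ_P (R : realFieldType) (n m k u : nat) : R :=
  prob (occ_law R n m k) (fun S => empties S == u).

(* Main.v *)
(* Let T be the action of the sum of all top-to-random moves, i.e. of the elements
   of Qset 1, on functions on the group, and let b_a be the indicator of Qset a
   divided by p^a a!.  Splitting the top-to-random moves by whether the top card is
   inserted at a position < a or >= a gives (T / p) b_a = a b_a + (a + 1) b_{a+1}, with b_{n+1} = 0.  Hence
   v_j = sum_a (-1)^(a+j) C(a,j) b_a satisfies (T / p) v_j = j v_j, and since
   (m + 1) b_{m+1} = (T / p - m) b_m, convolution by b_m multiplies v_j by C(j,m).
   Expanding delta_e = b_0 = sum_j v_j, the k-th power of b_m is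
   sum_j C(j,m)^k v_j.  Binomial inversion of C(j,m)^k, the number of k-tuples of
   m-subsets of a j-set, counts the tuples covering a given set, and turns this
   sum into the occupancy mixture of the b_a. *)
Require Import Defs.
From mathcomp Require Import all_boot all_order all_algebra all_fingroup.
From mathcomp Require Import zify ring.
Set Implicit Arguments.
Unset Strict Implicit.
Unset Printing Implicit Defensive.
Import Order.TTheory GRing.Theory Num.Theory.
Local Open Scope ring_scope.

(** * Label coordinates on colored permutations *)

(** An order-preserving bijection carries the initial segment below [x] onto the one below [s x], so
    the two have equal size. *)
Lemma perm_incr_eq1 (n : nat) (s : 'S_n) :
  (forall i j : 'I_n, (i < j)%N -> (s i < s j)%N) -> s = 1%g.
Proof.
move=> hs; apply/permP=> x; rewrite perm1; apply/val_inj => /=.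
have lts i j : (s i < s j)%N = (i < j)%N.
  apply/idP/idP; last exact: hs.
  by case: (ltngtP i j) => // [/hs | /val_inj ->]; lia.
have card_lt (y : 'I_n) : #|[set i : 'I_n | (i < y)%N]| = y.
  rewrite -sum1dep_card (big_ord_narrow (ltnW (ltn_ord y))) /=.
  by rewrite sum_nat_const card_ord muln1.
rewrite -[LHS]card_lt -[RHS]card_lt -[in RHS](card_imset _ (@perm_inj _ s)).
apply: eq_card => y; rewrite inE; apply/idP/imsetP => [lt_y|[w]].
  by exists ((s^-1)%g y); rewrite ?permKV // inE -lts permKV.
by rewrite inE => lt_w ->; rewrite lts.
Qed.

(** Coordinates indexed by labels: left multiplication merely relabels them, up to a color shift. *)
Definition pos (n p : nat) (x : cperm n p) (j : 'I_n) : 'I_n :=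
  (label x)^-1%g j.

Definition hue (n p : nat) (x : cperm n p) (j : 'I_n) : Cyc p :=
  color x (pos x j).

Lemma QsetP (n p a : nat) (x : cperm n p) :
  reflect ((forall i j : 'I_n, (a <= i)%N -> (i < j)%N ->
              (pos x i < pos x j)%N)
           /\ (forall j : 'I_n, (a <= j)%N -> hue x j = 0))
    (x \in Qset n p a).
Proof.
rewrite inE; apply: (iffP andP) => -[h1 h2]; split.
- by move=> i j ai ij; move/forallP/(_ i)/forallP/(_ j)/implyP: h1; apply; rewrite ai.
- by move=> j aj; apply/eqP; move/forallP/(_ j)/implyP: h2; apply.
- by apply/forallP=> i; apply/forallP=> j; apply/implyP=> /andP[]; apply: h1.
- by apply/forallP=> j; apply/implyP=> aj; apply/eqP; apply: h2.
Qed.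

Lemma Qset0 (n p : nat) : Qset n p 0 = [set 1%g].
Proof.
apply/setP=> x; rewrite in_set1; apply/idP/eqP => [/QsetP [h1 h2]|->].
  have eq1 : ((label x)^-1 = 1)%g.
    by apply: perm_incr_eq1 => i j; apply: h1.
  have eqc : color x = [ffun=> 0].
    apply/ffunP=> i; rewrite ffunE.
    by have := h2 i isT; rewrite /hue /pos eq1 perm1.
  by case: x {h1 h2} eq1 eqc => c s /= /(canRL invgK) -> ->; rewrite invg1.
apply/QsetP; rewrite /hue /pos; split => [i j _|j _]; last by rewrite ffunE.
by rewrite /= invg1 !perm1.
Qed.

(** * Top-to-random moves and the sets [Qset] *)

(** The general element of [Qset n.+1 p 1]. Its label permutation is the cycle that sends [i] to 0,
    shifts smaller indices up by one and fixes larger ones. *)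
Definition topmove (n p : nat) (i : 'I_n.+1) (c : Cyc p) : cperm n.+1 p :=
  CPerm [ffun l => if l == i then c else 0] (lift_perm i ord0 1).

Lemma pos_topmoveV (n p : nat) (i : 'I_n.+1) (c : Cyc p) (z : cperm n.+1 p) l :
  pos ((topmove i c)^-1 * z)%g l = pos z (lift_perm i ord0 1 l).
Proof. by rewrite /pos /= invMg invgK permM. Qed.

Lemma hue_topmoveV (n p : nat) (i : 'I_n.+1) (c : Cyc p) (z : cperm n.+1 p) l :
  hue ((topmove i c)^-1 * z)%g l
  = hue z (lift_perm i ord0 1 l) - (if l == i then c else 0).
Proof.
rewrite /hue pos_topmoveV /= ffunE /= ffunE /= {1}/pos permKV permK ffunE.
by rewrite addrC.
Qed.

Lemma lift_perm_gt (n : nat) (i l : 'I_n.+1) :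
  (i < l)%N -> lift_perm i ord0 1 l = l.
Proof.
move=> il; case: (unliftP i l) => [k|] El; last by rewrite El ltnn in il.
rewrite {1}El lift_perm_lift perm1 El; apply/val_inj=> /=.
by move: il; rewrite El /= /bump; lia.
Qed.

Lemma lift_perm_lt (n : nat) (i l : 'I_n.+1) :
  (l < i)%N -> lift_perm i ord0 1 l = l.+1 :> nat.
Proof.
move=> il; case: (unliftP i l) => [k|] El; last by rewrite El ltnn in il.
rewrite {1}El lift_perm_lift perm1 El /=.
by move: il; rewrite El /= /bump; lia.
Qed.

(** The cycle moves only labels up to [i], all below [a], and the color shift affects only label
    [i]; [Qset] constrains only labels from [a] on. *)
Lemma topmoveV_Qset_lt (n p a : nat) (i : 'I_n.+1) (c : Cyc p) (z : cperm n.+1 p) :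
  (i < a)%N ->
  ((topmove i c)^-1 * z \in Qset n.+1 p a)%g = (z \in Qset n.+1 p a).
Proof.
move=> ia; have fixl (l : 'I_n.+1) : (a <= l)%N -> lift_perm i ord0 1 l = l.
  by move=> al; apply: lift_perm_gt; apply: leq_trans al.
apply/QsetP/QsetP => -[h1 h2]; split.
- move=> k l ak kl; have := h1 k l ak kl.
  by rewrite !pos_topmoveV !fixl //; lia.
- move=> j aj; have := h2 j aj.
  by rewrite hue_topmoveV fixl // ifN ?subr0 // -val_eqE /=; lia.
- by move=> k l ak kl; rewrite !pos_topmoveV !fixl ?h1 //; lia.
- by move=> j aj; rewrite hue_topmoveV fixl // ifN ?subr0 ?h2 // -val_eqE /=; lia.
Qed.

(** Encodes the slot of label 0 among the labels above [a]: those preceding it form the block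
    [a+1, ..., i], empty when [i = a]. *)
Definition insertion_at (n p a : nat) (z : cperm n.+1 p) (i : 'I_n.+1) : bool :=
  [forall l : 'I_n.+1, (a < l)%N ==> ((pos z l < pos z ord0)%N == (l <= i)%N)].

(** Labels [a, ..., n] of the product sit where [z] has [a+1, ..., i, 0, i+1, ..., n]. Increasing
    positions thus mean that the labels above [a] are ordered and that 0 separates those up to [i]
    from the rest; [c] must cancel the color of 0. *)
Lemma topmoveV_Qset_ge (n p a : nat) (i : 'I_n.+1) (c : Cyc p) (z : cperm n.+1 p) :
  (a <= i)%N ->
  ((topmove i c)^-1 * z \in Qset n.+1 p a)%g
  = [&& z \in Qset n.+1 p a.+1, insertion_at a z i & c == hue z ord0].
Proof.
move=> ai.
have pos_inj x y : pos z x = pos z y -> x = y by apply: perm_inj.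
have pred_lt (l : 'I_n.+1) : (a < l)%N -> (l <= i)%N ->
    exists2 k : 'I_n.+1, k.+1 = l & lift_perm i ord0 1 k = l.
  move=> al li; have lt_k : (l.-1 < n.+1)%N by have := ltn_ord l; lia.
  exists (Ordinal lt_k) => /=; first by lia.
  by apply/val_inj => /=; rewrite lift_perm_lt /=; lia.
apply/QsetP/and3P.
  move=> [h1 h2].
  have gtP (l : 'I_n.+1) : (i < l)%N -> (pos z ord0 < pos z l)%N.
    move=> il; have := h1 i l ai il.
    by rewrite !pos_topmoveV lift_perm_id lift_perm_gt.
  have leP (l : 'I_n.+1) : (a < l)%N -> (l <= i)%N -> (pos z l < pos z ord0)%N.
    move=> al li; have [k kl El] := pred_lt l al li.
    have := h1 k i; rewrite !pos_topmoveV lift_perm_id El; apply; lia.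
  split.
  - apply/QsetP; split.
      move=> k l ak kl; case: (leqP l i) => li.
        have [k' kk' Ek] := pred_lt k ak (leq_trans (ltnW kl) li).
        have [l' ll' El] := pred_lt l (ltn_trans ak kl) li.
        have := h1 k' l'; rewrite !pos_topmoveV Ek El; apply; lia.
      (* Here [k <= i < l], and label 0 lies between the two. *)
      case: (leqP k i) => ki.
        by apply: ltn_trans (leP k ak ki) (gtP l li).
      have := h1 k l; rewrite !pos_topmoveV !lift_perm_gt //; apply; lia.
    move=> l al; case: (leqP l i) => li.
      have [k kl El] := pred_lt l al li.
      have := h2 k; rewrite hue_topmoveV El ifN ?subr0; last first.
        by rewrite -val_eqE /=; lia.
      by apply; lia.
    have := h2 l; rewrite hue_topmoveV lift_perm_gt // ifN ?subr0; last first.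
      by rewrite -val_eqE /=; lia.
    by apply; lia.
  - apply/forallP=> l; apply/implyP=> al; apply/eqP.
    case: (leqP l i) => li; first exact: leP.
    by apply/negbTE; rewrite -leqNgt ltnW // gtP.
  - have := h2 i ai; rewrite hue_topmoveV lift_perm_id eqxx => /eqP.
    by rewrite subr_eq0 eq_sym.
move=> [/QsetP [h1 h2] /forallP hi /eqP ->].
have {}hi (l : 'I_n.+1) : (a < l)%N -> (pos z l < pos z ord0)%N = (l <= i)%N.
  by move=> al; have /implyP/(_ al)/eqP := hi l.
have gtP (l : 'I_n.+1) : (a < l)%N -> (i < l)%N -> (pos z ord0 < pos z l)%N.
  move=> al il; rewrite ltn_neqAle [(_ <= _)%N]leqNgt hi // -ltnNge il andbT.
  by apply/eqP=> /val_inj/pos_inj l0; rewrite -l0 in al.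
split=> [k l ak kl|j aj].
  rewrite !pos_topmoveV; case: (ltngtP l i) => [li|li|/val_inj li].
  - apply: h1; rewrite !lift_perm_lt //; lia.
  - rewrite (lift_perm_gt li); case: (ltngtP k i) => [ki|ki|/val_inj ki].
    + by apply: h1; rewrite lift_perm_lt //; lia.
    + by rewrite (lift_perm_gt ki); apply: h1 => //; lia.
    + by rewrite ki lift_perm_id gtP //; lia.
  - by subst l; rewrite lift_perm_id hi lift_perm_lt; lia.
rewrite hue_topmoveV; case: eqP => [->|/eqP]; first by rewrite lift_perm_id subrr.
rewrite -val_eqE subr0 /= => ji; apply: h2.
case: (ltngtP j i) ji => // h _; first by rewrite lift_perm_lt; lia.
by rewrite lift_perm_gt; lia.
Qed.

(** Take for [i0] the last label above [a] that precedes label 0; since labels above [a] are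
    ordered, exactly those up to [i0] precede it. *)
Lemma insertion_at_unique (n p a : nat) (z : cperm n.+1 p) :
  (a <= n)%N -> z \in Qset n.+1 p a.+1 ->
  exists2 i0 : 'I_n.+1, (a <= i0)%N &
    forall i : 'I_n.+1, (a <= i)%N -> insertion_at a z i = (i == i0).
Proof.
move=> an /QsetP [h1 _]; pose a' : 'I_n.+1 := inord a.
have Ea : a' = a :> nat by rewrite inordK.
(* The disjunct [l == a'] yields [i0 = a] when no label above [a] precedes label 0. *)
pose Q (l : 'I_n.+1) := (l == a') || (a < l)%N && (pos z l < pos z ord0)%N.
have Qa : Q a' by rewrite /Q eqxx.
case: (arg_maxnP (fun l : 'I_n.+1 => l : nat) Qa) => i0 Qi0 max_i0.
have ai0 : (a <= i0)%N by rewrite -Ea; apply: max_i0.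
have ins0 (l : 'I_n.+1) : (a < l)%N -> (pos z l < pos z ord0)%N = (l <= i0)%N.
  move=> al; apply/idP/idP => [lt0|li0]; first by apply: max_i0; rewrite /Q al lt0 orbT.
  case/orP: Qi0 => [/eqP Ei0|/andP[_ lt0]]; first by move: li0; rewrite Ei0 Ea; lia.
  move: li0; rewrite leq_eqVlt => /orP[/eqP/val_inj -> //|li0].
  by apply: ltn_trans lt0; apply: h1.
exists i0 => // i ai; apply/forallP/eqP => [hi|->]; last first.
  by move=> l; apply/implyP=> al; rewrite ins0.
have {}hi (l : 'I_n.+1) : (a < l)%N -> (l <= i0)%N = (l <= i)%N.
  by move=> al; have /implyP/(_ al)/eqP <- := hi l; rewrite ins0.
(* If the two differed, the larger would exceed [a] and be a label on which the comparisons
   disagree. *)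
apply/val_inj => /=; case: (ltngtP i i0) => // lt.
  by have := hi i0 (leq_ltn_trans ai lt); rewrite leqnn leqNgt lt.
by have := hi i (leq_ltn_trans ai0 lt); rewrite leqnn leqNgt lt.
Qed.

(* Set to 0 for n < a, where Qset is the whole group, so that the recursion of
   topmove_sum_Qind also holds at a = n. *)
Definition Qind (R : realFieldType) (n p a : nat) (z : cperm n p) : R :=
  ((a <= n)%N && (z \in Qset n p a))%:R.

(** The operator [T]: left convolution by the indicator of the top-to-random moves. *)
Definition topmove_sum (R : realFieldType) (n p : nat) (f : cperm n.+1 p -> R)
    (z : cperm n.+1 p) : R :=
  \sum_(i : 'I_n.+1) \sum_(c : Cyc p) f ((topmove i c)^-1 * z)%g.

(** Moves with [i < a] preserve membership; among those with [i >= a], exactly one slot and one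
    color work when [z] is in [Qset n.+1 p a.+1], and none otherwise. *)
Lemma topmove_sum_Qind (R : realFieldType) (n p a : nat) (z : cperm n.+1 p) :
  (a <= n.+1)%N ->
  topmove_sum (Qind R a) z
  = p.-1.+1%:R * a%:R * Qind R a z + Qind R a.+1 z.
Proof.
move=> an; rewrite /topmove_sum (bigID (fun i : 'I_n.+1 => (i < a)%N)) /=.
congr (_ + _).
  transitivity (\sum_(i < n.+1 | (i < a)%N) (p.-1.+1%:R * Qind R a z)).
    apply: eq_bigr => i ia; rewrite mulr_natl -[in RHS](card_ord p.-1.+1).
    by rewrite -sumr_const; apply: eq_bigr => c _; rewrite /Qind topmoveV_Qset_lt.
  rewrite (big_ord_narrow an) sumr_const card_ord -mulr_natr; ring.
(* At [a = n+1] no index [i >= a] exists, and the last indicator is 0 by convention. *)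
rewrite {2}/Qind ltnS; case: (leqP a n) => /= [le_an|lt_na]; last first.
  by rewrite big1 // => i; have := ltn_ord i; lia.
under eq_bigr => i.
  rewrite -leqNgt => ai.
  under eq_bigr do rewrite /Qind an /= topmoveV_Qset_ge //.
  over.
case: (boolP (z \in _)) => [zQ|_] /=; last first.
  by rewrite big1 // => i _; rewrite big1.
have [i0 ai0 hi] := insertion_at_unique le_an zQ.
rewrite (bigD1 i0) /= -?leqNgt // [X in _ + X]big1 => [|i /andP[]]; last first.
  by rewrite -leqNgt => ai /negbTE ii0; rewrite big1 // => c _; rewrite hi // ii0.
rewrite addr0 (bigD1 (hue z ord0)) //= hi // !eqxx big1 ?addr0 // => c.
by rewrite andTb => /negbTE ->.
Qed.

(** * Finite differences and binomial inversion *)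

(** By Pascal's rule, the difference of order [a+1] at 0 is that of order [a] of the first
    difference. *)
Lemma signed_bin_sum_diff (R : comRingType) (a : nat) (g : nat -> R) :
  \sum_(j < a.+2) (-1) ^+ (a.+1 + j) * 'C(a.+1, j)%:R * g j
  = \sum_(j < a.+1) (-1) ^+ (a + j) * 'C(a, j)%:R * (g j.+1 - g j).
Proof.
have sgn2 (b : nat) : (-1) ^+ (a.+1 + b.+1) = (-1) ^+ (a + b) :> R.
  by rewrite addSnnS !exprD !exprS; ring.
(* The second range extends to [a+1] at no cost, as [C(a, a+1) = 0], so that both sides can shed
   their term at 0. *)
transitivity (\sum_(j < a.+1) (-1) ^+ (a + j) * 'C(a, j)%:R * g j.+1
  - \sum_(j < a.+2) (-1) ^+ (a + j) * 'C(a, j)%:R * g j); last first.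
  rewrite [X in _ - X]big_ord_recr /= bin_small // mulr0 mul0r addr0 -sumrB.
  by apply: eq_bigr => j _; ring.
rewrite big_ord_recl [X in _ = _ - X]big_ord_recl /= !bin0 !addn0 exprS.
rewrite opprD addrCA -sumrB; congr (_ + _); first ring.
apply: eq_bigr => j _; rewrite /bump /= add1n sgn2 binS natrD addnS exprS; ring.
Qed.

(** The first difference of [C(j, l+1)] in [j] is [C(j, l)], so induction lowers [a] and [l]
    together. *)
Lemma signed_bin_orthogonal (R : comRingType) (n a l : nat) : (a <= n)%N ->
  \sum_(j < n.+1) (-1) ^+ (a + j) * 'C(a, j)%:R * 'C(j, l)%:R
  = (a == l)%:R :> R.
Proof.
move=> an.
transitivity (\sum_(j < a.+1) (-1) ^+ (a + j) * 'C(a, j)%:R * 'C(j, l)%:R : R).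
  have le_an1 : (a < n.+1)%N by [].
  rewrite (big_ord_widen _ (fun j => (-1) ^+ (a + j) * 'C(a, j)%:R * 'C(j, l)%:R : R) le_an1).
  rewrite [LHS](bigID (fun j : 'I_n.+1 => (j < a.+1)%N)) /= [X in _ + X]big1 ?addr0 //.
  by move=> j; rewrite -leqNgt => aj; rewrite bin_small // mulr0 mul0r.
elim: a l {an} => [|a IHa] l.
  by rewrite big_ord1 /= bin0 !mul1r; case: l => [|l]; rewrite ?bin0 ?bin0n.
rewrite (signed_bin_sum_diff a (fun j => 'C(j, l)%:R)).
case: l => [|l].
  by rewrite big1 // => j _; rewrite !bin0 subrr mulr0.
rewrite eqSS -IHa; apply: eq_bigr => j _.
by rewrite binS natrD; ring.
Qed.

(** For [a <= n], the finite difference of order [a] of [g] at 0; the range is independent of [a] so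
    that sums can be exchanged. *)
Definition bin_transform (R : comRingType) (n : nat) (g : nat -> R) (a : nat) : R :=
  \sum_(i < n.+1) (-1) ^+ (a + i) * 'C(a, i)%:R * g i.

(** Newton's forward difference formula, from orthogonality. *)
Lemma bin_transformK (R : comRingType) (n : nat) (g : nat -> R) (j : nat) :
  (j <= n)%N ->
  \sum_(a < n.+1) 'C(j, a)%:R * bin_transform n g a = g j.
Proof.
move=> jn; under eq_bigr do rewrite mulr_sumr.
rewrite exchange_big /=.
(* Inserting [(-1)^j] twice gives the inner sum the signs of [signed_bin_orthogonal]. *)
transitivity (\sum_(i < n.+1) (-1) ^+ (j + i) * g i *
   (\sum_(a < n.+1) (-1) ^+ (j + a) * 'C(j, a)%:R * 'C(a, i)%:R)).
  apply: eq_bigr => i _; rewrite mulr_sumr; apply: eq_bigr => a _.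
  have : (-1) ^+ j * (-1) ^+ j = 1 :> R by rewrite -expr2 sqrr_sign.
  rewrite !exprD => H; transitivity ((-1) ^+ j * (-1) ^+ j *
     ('C(j, a)%:R * ((-1) ^+ a * (-1) ^+ i * 'C(a, i)%:R * g i))); last ring.
  by rewrite H mul1r.
under eq_bigr do rewrite signed_bin_orthogonal //.
rewrite (bigD1 (Ordinal (jn : (j < n.+1)%N))) //= eqxx mulr1 -signr_odd oddD addbb mul1r.
rewrite big1 ?addr0 // => i ij; rewrite (_ : (j == i) = false) ?mulr0 //.
by apply/negbTE; rewrite eq_sym; exact: ij.
Qed.

Lemma bin_transform_rev (R : comRingType) (n : nat) (g : nat -> R) (a : nat) :
  (a <= n)%N ->
  bin_transform n g a
  = \sum_(0 <= j < a.+1) (-1) ^+ j * 'C(a, j)%:R * g (a - j)%N.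
Proof.
move=> an; rewrite /bin_transform.
have -> : \sum_(i < n.+1) (-1) ^+ (a + i) * 'C(a, i)%:R * g i
    = \sum_(i < a.+1) (-1) ^+ (a + i) * 'C(a, i)%:R * g i.
  have le_an1 : (a < n.+1)%N by [].
  rewrite [RHS](big_ord_widen _ (fun j => (-1) ^+ (a + j) * 'C(a, j)%:R * g j) le_an1).
  rewrite [LHS](bigID (fun j : 'I_n.+1 => (j < a.+1)%N)) /= [X in _ + X]big1 ?addr0 //.
  by move=> j; rewrite -leqNgt => aj; rewrite bin_small // mulr0 mul0r.
rewrite -(big_mkord xpredT (fun i => (-1) ^+ (a + i) * 'C(a, i)%:R * g i)).
rewrite big_nat_rev /= !big_nat; apply: eq_bigr => j /andP[_ ja].
rewrite add0n subSS bin_sub; last by rewrite -ltnS.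
(* [a + (a - j)] and [j] have the same parity. *)
congr (_ * _ * _); rewrite -signr_odd -[RHS]signr_odd; congr (_ ^+ nat_of_bool _).
by rewrite oddD oddB -1?ltnS // addKb.
Qed.

(** * Counting tuples by their union: the occupancy law *)

Definition covers (n m k : nat) (A : {set 'I_n}) :
    {set {ffun 'I_k -> {set 'I_n}}} :=
  [set S : {ffun 'I_k -> {set 'I_n}} |
    [forall t, #|S t| == m] && (\bigcup_(t < k) S t == A)].

(** The [k]-tuples of [m]-subsets of [A] are classified by their union. *)
Lemma sum_card_covers (n m k : nat) (A : {set 'I_n}) :
  (\sum_(B : {set 'I_n} | B \subset A) #|covers m k B| = 'C(#|A|, m) ^ k)%N.
Proof.
pose D := [set B : {set 'I_n} | (B \subset A) && (#|B| == m)].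
have <- : #|[set S : {ffun 'I_k -> {set 'I_n}} | S \in ffun_on D]|
    = ('C(#|A|, m) ^ k)%N.
  by rewrite cardsE card_ffun_on card_ord cards_draws.
rewrite -[RHS]sum1_card (partition_big
  (fun S : {ffun 'I_k -> {set 'I_n}} => \bigcup_(t < k) S t)
  (fun B : {set 'I_n} => B \subset A)) /=; last first.
  move=> S; rewrite inE => /ffun_onP hS; apply/bigcupsP=> t _.
  by have := hS t; rewrite inE => /andP[].
apply: eq_bigr => B BA; rewrite -sum1_card; apply: eq_bigl => S.
rewrite !inE; apply/andP/andP => -[].
  move=> /forallP hS /eqP SB; rewrite SB; split => //.
  apply/ffun_onP => t; rewrite inE hS andbT.
  by apply: subset_trans BA; rewrite -SB (bigcup_max t).
move=> /ffun_onP hS ->; split=> //.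
by apply/forallP=> t; have := hS t; rewrite inE => /andP[].
Qed.

(** Both sides have the same sums over the subsets of any set, by [sum_card_covers] and by
    [bin_transformK] after grouping by size. Induction on the size of [A] cancels the proper
    subsets. *)
Lemma card_covers (R : comRingType) (n m k : nat) (A : {set 'I_n}) :
  #|covers m k A|%:R
  = bin_transform n (fun j => ('C(j, m) ^ k)%N%:R) #|A| :> R.
Proof.
pose N a : R := bin_transform n (fun j => ('C(j, m) ^ k)%N%:R) a.
have sumN (B : {set 'I_n}) :
    \sum_(C : {set 'I_n} | C \subset B) N #|C| = ('C(#|B|, m) ^ k)%N%:R.
  have cardB : (#|B| <= n)%N by rewrite -[n in X in (_ <= X)%N]card_ord max_card.
  rewrite -(bin_transformK (fun j => ('C(j, m) ^ k)%N%:R : R) cardB).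
  rewrite (partition_big (fun C : {set 'I_n} => inord #|C| : 'I_n.+1) xpredT) //=.
  apply: eq_bigr => a _; rewrite -cards_draws mulr_natl -sumr_const.
  have ina (C : {set 'I_n}) : (inord #|C| == a :> 'I_n.+1) = (#|C| == a).
    by rewrite -val_eqE /= inordK // ltnS -[n in X in (_ <= X)%N]card_ord max_card.
  apply: eq_big => [C|C /andP[_]]; first by rewrite inE ina.
  by rewrite ina => /eqP ->.
have [c] := ubnP #|A|; elim: c A => // c IHc A /ltnSE leAc.
have := sumN A; rewrite -sum_card_covers natr_sum.
rewrite [LHS](bigD1 A) ?subxx //= [RHS](bigD1 A) ?subxx //=.
have -> : \sum_(C : {set 'I_n} | (C \subset A) && (C != A)) #|covers m k C|%:R
    = \sum_(C : {set 'I_n} | (C \subset A) && (C != A)) N #|C| :> R.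
  apply: eq_bigr => C /andP[CA neqCA]; apply: IHc.
  by apply: leq_trans leAc; apply: proper_card; rewrite properEneq neqCA.
by move/addIr.
Qed.

Lemma occ_lawE (R : realFieldType) (n m k : nat) (S : {ffun 'I_k -> {set 'I_n}}) :
  occ_law R n m k S
  = if [forall t, #|S t| == m] then ('C(n, m)%:R ^+ k)^-1 else 0.
Proof.
rewrite ffunE; case: ifPn => [/forallP hS|].
  rewrite -exprVn -[k in RHS]card_ord -prodr_const; apply: eq_bigr => t _.
  by rewrite ffunE inE hS card_draws card_ord.
rewrite negb_forall => /existsP[t St].
by rewrite (bigD1 t) //= ffunE inE (negbTE St) mul0r.
Qed.

(** Each of the [C(n, a)] possible unions of size [a] arises from equally many tuples, and all
    tuples of [m]-sets are equally likely. *)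
Lemma occ_muE (R : realFieldType) (n m k a : nat) :
  occ_mu R n m k a
  = ('C(n, m)%:R ^+ k)^-1 * 'C(n, a)%:R
    * bin_transform n (fun j => ('C(j, m) ^ k)%N%:R) a.
Proof.
rewrite /occ_mu /prob (partition_big
  (fun S : {ffun 'I_k -> {set 'I_n}} => \bigcup_(t < k) S t)
  (fun A : {set 'I_n} => A \in [set A : {set 'I_n} | #|A| == a])) /=; last first.
  by move=> S; rewrite inE.
rewrite -[in 'C(n, a)](card_ord n) -card_draws mulrAC mulr_natr -sumr_const.
apply: eq_bigr => A; rewrite inE => /eqP <-.
rewrite -card_covers mulr_natr -sumr_const.
under eq_bigr do rewrite occ_lawE.
rewrite -big_mkcondr; apply: eq_bigl => S; rewrite inE /occupied andbC.
by case: (_ =P A) => [->|_]; rewrite ?eqxx ?andbF.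
Qed.

(** * The move operator under sums and convolution; the size of [Qset] *)

Lemma topmove_sum_lin (R : realFieldType) (n p : nat) (I : finType)
    (c : I -> R) (F : I -> cperm n.+1 p -> R) (z : cperm n.+1 p) :
  topmove_sum (fun y => \sum_i c i * F i y) z
  = \sum_i c i * topmove_sum (F i) z.
Proof.
rewrite /topmove_sum; under eq_bigr do rewrite exchange_big /=.
rewrite exchange_big /=; apply: eq_bigr => i _.
rewrite mulr_sumr; apply: eq_bigr => l _.
by rewrite mulr_sumr.
Qed.

Lemma topmove_sum_conv (R : realFieldType) (n p : nat)
    (f g : {ffun cperm n.+1 p -> R}) (z : cperm n.+1 p) :
  \sum_u topmove_sum f (z * u^-1)%g * g u = topmove_sum (conv f g) z.
Proof.
rewrite /topmove_sum.
transitivity (\sum_u \sum_i \sum_c f ((topmove i c)^-1 * z * u^-1)%g * g u).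
  apply: eq_bigr => u _; rewrite mulr_suml; apply: eq_bigr => i _.
  by rewrite mulr_suml; apply: eq_bigr => c _; rewrite mulgA.
rewrite exchange_big /=; apply: eq_bigr => i _.
by rewrite exchange_big /=; apply: eq_bigr => c _; rewrite ffunE.
Qed.

Lemma sum_topmove_sum (R : realFieldType) (n p : nat) (f : cperm n.+1 p -> R) :
  \sum_z topmove_sum f z = n.+1%:R * p.-1.+1%:R * \sum_z f z.
Proof.
rewrite /topmove_sum exchange_big /=.
transitivity (\sum_(i < n.+1) p.-1.+1%:R * \sum_z f z).
  apply: eq_bigr => i _; rewrite exchange_big /= mulr_natl.
  rewrite -[in RHS](card_ord p.-1.+1) -sumr_const; apply: eq_bigr => c _.
  by rewrite [RHS](reindex_inj (mulgI (topmove i c)^-1%g)).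
by rewrite sumr_const card_ord -[LHS]mulr_natl mulrA.
Qed.

(** Summing [topmove_sum_Qind] over the group gives, for [p >= 1], the ratio [p (n+1-a)] of
    consecutive sizes. *)
Lemma card_Qset (n p a : nat) : (a <= n.+1)%N ->
  #|Qset n.+1 p a| = (p.-1.+1 ^ a * n.+1 ^_ a)%N.
Proof.
elim: a => [|a IHa] an; first by rewrite Qset0 cards1.
have sum_ind b : (b <= n.+1)%N -> \sum_(z : cperm n.+1 p) Qind rat b z = #|Qset n.+1 p b|%:R.
  move=> bn; rewrite -sum1_card natr_sum [RHS]big_mkcond /=; apply: eq_bigr => z _.
  by rewrite /Qind bn; case: (_ \in _).
(* The identity lives in a field; it is read in [rat] and brought back to [nat]. *)
have := sum_topmove_sum (@Qind rat n.+1 p a).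
under eq_bigr do rewrite (topmove_sum_Qind _ _ (ltnW an)).
rewrite big_split /= -mulr_sumr !sum_ind //; last exact: ltnW.
rewrite -!natrM -natrD => /eqP; rewrite eqr_nat => /eqP.
rewrite IHa; last exact: ltnW.
rewrite ffactnSr expnS => card_eq.
apply: (@addnI (p.-1.+1 * a * (p.-1.+1 ^ a * n.+1 ^_ a))%N).
rewrite card_eq -{1}(subnKC (ltnW an)); ring.
Qed.

(** * Normalized indicators and eigenfunctions of the move operator *)

(** The [b_a] of the overview, of total mass [C(n, a)] for [a <= n]. *)
Definition Qhat (R : realFieldType) (n p a : nat) : {ffun cperm n p -> R} :=
  [ffun z => Qind R a z / (p.-1.+1 ^ a * a`!)%N%:R].

Lemma QtE (R : realFieldType) (n p a : nat) (z : cperm n.+1 p) :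
  (a <= n.+1)%N -> Qt R n.+1 p a z = 'C(n.+1, a)%:R^-1 * Qhat R n.+1 p a z.
Proof.
move=> an; rewrite !ffunE /Qind an card_Qset // -bin_ffact.
case: (_ \in _); last by rewrite mul0r mulr0.
by rewrite mulrCA !natrM mul1r -!invfM mulrC; congr (_^-1); ring.
Qed.

Lemma topmove_sum_Qhat (R : realFieldType) (n p a : nat) (z : cperm n.+1 p) :
  (a <= n.+1)%N ->
  topmove_sum (Qhat R n.+1 p a) z
  = p.-1.+1%:R * (a%:R * Qhat R n.+1 p a z + a.+1%:R * Qhat R n.+1 p a.+1 z).
Proof.
move=> an; have -> : topmove_sum (Qhat R n.+1 p a) z
    = topmove_sum (Qind R a) z / (p.-1.+1 ^ a * a`!)%N%:R.
  rewrite /topmove_sum mulr_suml; apply: eq_bigr => i _.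
  by rewrite mulr_suml; apply: eq_bigr => c _; rewrite ffunE.
rewrite topmove_sum_Qind // !ffunE expnS factS !natrM.
have q0 : p.-1.+1%:R != 0 :> R by rewrite pnatr_eq0.
have a0 : a.+1%:R != 0 :> R by rewrite pnatr_eq0.
have f0 : a`!%:R != 0 :> R by rewrite pnatr_eq0 -lt0n fact_gt0.
have e0 : (p.-1.+1 ^ a)%N%:R != 0 :> R by rewrite pnatr_eq0 expn_eq0.
by move: q0 a0 f0 e0; move: (p.-1.+1%:R) (a.+1%:R) (a`!%:R) ((p.-1.+1 ^ a)%N%:R) => q s f e *; field; apply/and4P.
Qed.

Lemma Qhat0 (R : realFieldType) (n p : nat) : Qhat R n p 0 = dirac R 1%g.
Proof. by apply/ffunP=> z; rewrite !ffunE /Qind Qset0 in_set1 divr1. Qed.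

(** The eigenfunction [v_j] of the overview. *)
Definition Qeig (R : realFieldType) (n p j : nat) : {ffun cperm n p -> R} :=
  [ffun z => \sum_(a < n.+1) (-1) ^+ (a + j) * 'C(a, j)%:R * Qhat R n p a z].

Lemma Qhat_Qeig (R : realFieldType) (n p l : nat) (z : cperm n p) :
  (l <= n)%N -> Qhat R n p l z = \sum_(j < n.+1) 'C(j, l)%:R * Qeig R n p j z.
Proof.
move=> ln; under eq_bigr do rewrite ffunE mulr_sumr.
rewrite exchange_big /=.
transitivity (\sum_(a < n.+1) (a == l :> nat)%:R * Qhat R n p a z).
  rewrite (bigD1 (Ordinal (ln : (l < n.+1)%N))) //= eqxx mul1r.
  rewrite big1 ?addr0 // => a al; rewrite (_ : (a == l :> nat) = false) ?mul0r //.
  by apply/negbTE; exact: al.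
apply: eq_bigr => a _; rewrite -(signed_bin_orthogonal _ l (ltn_ord a : (a <= n)%N)).
by rewrite mulr_suml; apply: eq_bigr => j _; ring.
Qed.

Lemma topmove_sum_Qeig (R : realFieldType) (n p j : nat) (z : cperm n.+1 p) :
  topmove_sum (Qeig R n.+1 p j) z = p.-1.+1%:R * j%:R * Qeig R n.+1 p j z.
Proof.
have -> : topmove_sum (Qeig R n.+1 p j) z
  = topmove_sum (fun y => \sum_(a < n.+2)
      (-1) ^+ (a + j) * 'C(a, j)%:R * Qhat R n.+1 p a y) z.
  by apply: eq_bigr => i _; apply: eq_bigr => c _; rewrite ffunE.
rewrite topmove_sum_lin.
under eq_bigr => a _ do rewrite (topmove_sum_Qhat _ _ (ltn_ord a : (a <= n.+1)%N)).
rewrite ffunE -mulrA mulr_sumr [in RHS]mulr_sumr.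
pose h a : R := Qhat R n.+1 p a z.
(* The recursion stops at the top, so shifting the second sum by one loses no term. *)
have h_top : h n.+2 = 0 by rewrite /h ffunE /Qind ltnn mul0r.
pose q : R := p.-1.+1%:R.
transitivity (\sum_(a < n.+2) q * ((-1) ^+ (a + j) * 'C(a, j)%:R * a%:R * h a)
  + \sum_(a < n.+2) q * ((-1) ^+ (a + j) * 'C(a, j)%:R * a.+1%:R * h a.+1)).
  by rewrite -big_split /=; apply: eq_bigr => a _; rewrite /h /q; ring.
rewrite [X in _ + X]big_ord_recr /= h_top !mulr0 addr0.
rewrite big_ord_recl [RHS]big_ord_recl /= !mulr0 mul0r mulr0 add0r.
have -> : q * (j%:R * ((-1) ^+ (0 + j) * 'C(0, j)%:R * h 0)) = 0.
  by case: j => [|j]; rewrite ?mul0r ?bin0n ?mulr0 ?mul0r ?mulr0.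
rewrite add0r -big_split /=; apply: eq_bigr => a _; rewrite /bump /= !add1n.
(* The right side is, up to sign, the coefficient of [b_(a+1)] collected from the indices [a+1] and
   [a]. *)
have : j%:R * 'C(a.+1, j)%:R = a.+1%:R * ('C(a.+1, j)%:R - 'C(a, j)%:R) :> R.
  case: j => [|j]; first by rewrite !bin0; ring.
  by rewrite -natrM -mul_bin_diag natrM binS natrD; ring.
rewrite addSn exprS => E.
transitivity (- q * (-1) ^+ (a + j) * h a.+1 *
  (a.+1%:R * ('C(a.+1, j)%:R - 'C(a, j)%:R))); first ring.
by rewrite -E /h; ring.
Qed.

(** * Convolution on the eigenfunctions and convolution powers *)

Lemma conv1 (R : realFieldType) (gT : finGroupType) (f : {ffun gT -> R}) :
  conv (dirac R 1%g) f = f.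
Proof.
apply/ffunP=> z; rewrite ffunE (bigD1 z) //= ffunE mulgV eqxx mul1r.
rewrite big1 ?addr0 // => u uz; rewrite ffunE -eq_mulgV1 eq_sym.
by rewrite (negbTE uz) mul0r.
Qed.

Lemma conv_sumr (R : realFieldType) (gT : finGroupType) (I : finType)
    (M : {ffun gT -> R}) (c : I -> R) (F : I -> {ffun gT -> R}) (z : gT) :
  conv M [ffun y => \sum_i c i * F i y] z = \sum_i c i * conv M (F i) z.
Proof.
rewrite ffunE; under eq_bigr do rewrite ffunE mulr_sumr.
rewrite exchange_big /=; apply: eq_bigr => i _; rewrite ffunE mulr_sumr.
by apply: eq_bigr => u _; rewrite mulrCA.
Qed.

(** Induction on [m]: the recursion expresses [b_(m+1)] through [T b_m] and [b_m], and [T] passes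
    from [b_m] to the convolution, where it acts by [p j]. *)
Lemma conv_Qhat_Qeig (R : realFieldType) (n p m j : nat) (z : cperm n.+1 p) :
  (m <= n.+1)%N ->
  conv (Qhat R n.+1 p m) (Qeig R n.+1 p j) z = 'C(j, m)%:R * Qeig R n.+1 p j z.
Proof.
elim: m z => [|m IHm] z mn; first by rewrite Qhat0 conv1 bin0 mul1r.
have {}IHm y := IHm y (ltnW mn).
have q0 : p.-1.+1%:R != 0 :> R by rewrite pnatr_eq0.
have m0 : m.+1%:R != 0 :> R by rewrite pnatr_eq0.
apply: (mulfI (mulf_neq0 q0 m0)).
set v := Qeig R n.+1 p j in IHm *; set b := Qhat R n.+1 p.
transitivity (\sum_u topmove_sum (b m) (z * u^-1)%g * v u
              - p.-1.+1%:R * m%:R * conv (b m) v z).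
  rewrite [conv (b m.+1) v z]ffunE [conv (b m) v z]ffunE !mulr_sumr -sumrB.
  apply: eq_bigr => u _; rewrite topmove_sum_Qhat; last exact: ltnW.
  rewrite -/(b m) -/(b m.+1); move: (b m _) (b m.+1 _) (v u) => x y w; ring.
rewrite topmove_sum_conv IHm.
have -> : topmove_sum (conv (b m) v) z = 'C(j, m)%:R * topmove_sum v z.
  rewrite /topmove_sum mulr_sumr; apply: eq_bigr => i _.
  by rewrite mulr_sumr; apply: eq_bigr => c _; rewrite IHm.
rewrite topmove_sum_Qeig.
(* The subtraction is in [R], hence possibly negative; for [j < m] both binomials vanish. *)
have E : m.+1%:R * 'C(j, m.+1)%:R = (j%:R - m%:R) * 'C(j, m)%:R :> R.
  case: (leqP m j) => mj; first by rewrite -natrB // -!natrM mul_bin_left.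
  by rewrite !bin_small ?mulr0 // ltnW.
transitivity (p.-1.+1%:R * ((j%:R - m%:R) * 'C(j, m)%:R) * v z).
  by rewrite /v; ring.
by rewrite -E; ring.
Qed.

(** The Dirac mass is the sum of all [v_j], and each factor multiplies [v_j] by
    [C(j, m) / C(n+1, m)]. *)
Lemma convpow_Qt (R : realFieldType) (n p m k : nat) (z : cperm n.+1 p) :
  (m <= n.+1)%N ->
  convpow (Qt R n.+1 p m) k z
  = ('C(n.+1, m)%:R ^+ k)^-1
    * \sum_(j < n.+2) ('C(j, m) ^ k)%N%:R * Qeig R n.+1 p j z.
Proof.
move=> mn; elim: k z => [|k IHk] z.
  rewrite /convpow /= expr0 invr1 mul1r -Qhat0 Qhat_Qeig //.
  by apply: eq_bigr => j _; rewrite bin0.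
have -> : convpow (Qt R n.+1 p m) k.+1
    = conv (Qt R n.+1 p m) (convpow (Qt R n.+1 p m) k) by [].
have -> : convpow (Qt R n.+1 p m) k
    = [ffun y => \sum_(j < n.+2) ('C(n.+1, m)%:R ^+ k)^-1 * ('C(j, m) ^ k)%N%:R
                  * Qeig R n.+1 p j y].
  apply/ffunP=> y; rewrite IHk ffunE mulr_sumr.
  by apply: eq_bigr => j _; rewrite mulrA.
rewrite conv_sumr mulr_sumr; apply: eq_bigr => j _.
have -> : conv (Qt R n.+1 p m) (Qeig R n.+1 p j) z
    = 'C(n.+1, m)%:R^-1 * conv (Qhat R n.+1 p m) (Qeig R n.+1 p j) z.
  rewrite !ffunE mulr_sumr; apply: eq_bigr => u _.
  by rewrite QtE // mulrA.
rewrite conv_Qhat_Qeig // exprS invfM expnS natrM; ring.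
Qed.

Lemma convpow_Qt_mixture (R : realFieldType) (n p m k : nat) (z : cperm n.+1 p) :
  (m <= n.+1)%N ->
  convpow (Qt R n.+1 p m) k z
  = \sum_(a < n.+2) occ_mu R n.+1 m k a * Qt R n.+1 p a z.
Proof.
move=> mn; rewrite convpow_Qt //.
pose N a : R := bin_transform n.+1 (fun j => ('C(j, m) ^ k)%N%:R) a.
(* Newton's formula expands [C(j, m)^k] in the [C(j, a)], and summing [C(j, a) v_j] over [j]
   restores [b_a]. *)
transitivity (('C(n.+1, m)%:R ^+ k)^-1
  * \sum_(a < n.+2) N a * Qhat R n.+1 p a z).
  congr (_ * _).
  under [RHS]eq_bigr => a _ do rewrite (Qhat_Qeig _ _ (ltn_ord a : (a <= n.+1)%N)) mulr_sumr.
  rewrite exchange_big /=; apply: eq_bigr => j _.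
  rewrite -(bin_transformK (fun j => ('C(j, m) ^ k)%N%:R : R) (ltn_ord j : (j <= n.+1)%N)).
  by rewrite mulr_suml; apply: eq_bigr => a _; rewrite mulrA [N a * _]mulrC.
rewrite mulr_sumr; apply: eq_bigr => a _.
have an : (a <= n.+1)%N := ltn_ord a.
have C0 : 'C(n.+1, a)%:R != 0 :> R by rewrite pnatr_eq0 -lt0n bin_gt0.
rewrite occ_muE QtE // -/(N a).
move: C0 ('C(n.+1, m)%:R ^+ k)^-1; move: ('C(n.+1, a)%:R : R) => C C0 D.
by field.
Qed.

Theorem lemma4p3 (R : realFieldType) (n p m k : nat)
    (hp : (1 <= p)%N) (hm : (1 <= m)%N) (hmn : (m <= n)%N) :
  [/\ (forall z : cperm n p,
         convpow (Qt R n p m) k z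
         = \sum_(0 <= a < n.+1) occ_mu R n m k a * Qt R n p a z),
      (forall z : cperm n p,
         convpow (Qt R n p m) k z
         = \sum_(0 <= u < n.+1) occ_P R n m k u * Qt R n p (n - u)%N z),
      (forall u : nat, (u <= n)%N ->
         occ_P R n m k u = occ_mu R n m k (n - u)%N)
    & ((1 <= k)%N -> forall a : nat, (a <= n)%N ->
         occ_mu R n m k a
         = ((n ^_ m)%:R ^+ k)^-1 * 'C(n, a)%:R
           * \sum_(0 <= j < a.+1)
               (-1) ^+ j * 'C(a, j)%:R * ((a - j) ^_ m)%:R ^+ k)].
Proof.
have mixture (z : cperm n p) : convpow (Qt R n p m) k z
    = \sum_(0 <= a < n.+1) occ_mu R n m k a * Qt R n p a z.
  (* Size 0 is excluded by [1 <= m <= n]. *)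
  rewrite big_mkord; case: n hmn z => [|n'] hmn' z; last exact: convpow_Qt_mixture.
  by move: hm; rewrite ltnNge hmn'.
have PE u : (u <= n)%N -> occ_P R n m k u = occ_mu R n m k (n - u)%N.
  move=> un; apply: eq_bigl => S; rewrite /empties.
  have : (occupied S <= n)%N by rewrite -[n in X in (_ <= X)%N]card_ord max_card.
  by move=> Sn; apply/eqP/eqP; lia.
split=> // [z|_ a an].
  rewrite mixture big_nat_rev /= !big_nat; apply: eq_bigr => u /andP[_ un].
  by rewrite add0n subSS PE.
rewrite occ_muE bin_transform_rev // mulr_sumr [RHS]mulr_sumr.
apply: eq_bigr => j _.
(* Passing from binomials to falling factorials puts the same power of the factorial of [m] above
   and below. *)
have ffactE x : (x ^_ m)%:R ^+ k = ('C(x, m) ^ k)%N%:R * (m`! ^ k)%N%:R :> R.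
  by rewrite -bin_ffact natrM exprMn !natrX.
have f0 : (m`! ^ k)%N%:R != 0 :> R by rewrite natrX expf_neq0 // pnatr_eq0 -lt0n fact_gt0.
have C0 : ('C(n, m) ^ k)%N%:R != 0 :> R.
  by rewrite natrX expf_neq0 // pnatr_eq0 -lt0n bin_gt0.
rewrite !ffactE -natrX.
move: f0 C0; move: ((m`! ^ k)%N%:R : R) (('C(n, m) ^ k)%N%:R : R) => x y x0 y0.
by field; apply/andP.
Qed.
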